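(* Let $0<a<b<+\infty$ and let $\varrho\ge0$ be a non-decreasing bounded function on $[a,b]$. Let $(w,\lambda)$, with $w:[a,b]\to\mathbb{R}$ Lipschitz and $\lambda\in\mathbb{R}$, solve $$w'+\lambda w^2=(1/x+\varrho)w\ \text{ a.e. on }(a,b),\qquad w(a)=w(b)=1.$$ Let $w_0$ denote the solution function of this problem in the case $\varrho\equiv0$ on $[a,b]$. Assume that $w>1$ on $(a,b)$. Put $T:=\min\{\|w_0\|_\infty,\|w\|_\infty\}>1$. Then (i) $\mu_w(t)\le\mu_{w_0}(t)$ for each $t\in[1,T)$; (ii) $\|w\|_\infty\le\|w_0\|_\infty$; (iii) if $\varrho\not\equiv0$ on $[a,b)$ then there exists $t_0\in(1,\|w\|_\infty)$ such that $\mu_w(t)<\mu_{w_0}(t)$ for each $t\in(1,t_0)$.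
   Context: The measure $\mu$ on the Lebesgue measurable subsets of $[0,+\infty)$ is $\mu(dx)=(1/x)\,dx$. For a measurable $u:[a,b]\to\mathbb{R}$ the distribution function is $\mu_u(t):=\mu(\{x\in[a,b]:u(x)>t\})$ for $t>0$. The boundary value problem in the statement has, for each such $\varrho$, a unique solution pair $(w,\lambda)$ with $w$ Lipschitz on $[a,b]$; the same applies for $\varrho\equiv 0$. $\|\cdot\|_\infty$ is the supremum norm on $[a,b]$. *)

(* Defs.v *)
From HB Require Import structures.
From mathcomp Require Export all_boot all_order all_algebra.
From mathcomp Require Export all_classical all_reals all_analysis.
Export Order.TTheory GRing.Theory Num.Theory numFieldNormedType.Exports.

Set Implicit Arguments.
Unset Strict Implicit.
Unset Printing Implicit Defensive.

Local Open Scope classical_set_scope.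
Local Open Scope ring_scope.

(* mu(dx) = (1/x) dx on [0, +oo[. On a Lebesgue measurable, possibly non-Borel,
   subset of [0, +oo[ this is still the expected value: a nonnegative integral
   is a supremum over Borel simple functions and hence unchanged by Lebesgue
   null sets. The point 0, where 0^-1 = 0, is null. *)
Definition mu_inv (R : realType) (A : set R) : \bar R :=
  (\int[@lebesgue_measure R]_(x in A) (x^-1)%:E)%E.

Definition distribution_fun (R : realType) (a b : R) (u : R -> R) (t : R) :
    \bar R :=
  mu_inv [set x | x \in `[a, b] /\ t < u x].

Definition sup_norm (R : realType) (a b : R) (u : R -> R) : R :=
  sup [set `|u x| | x in `[a, b]].

(* Functions on [a, b] are total functions R -> R of which only the values on
   [a, b] are constrained; the derivative is taken at points of ]a, b[ only, so
   it does not depend on the values outside. *)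
Definition bvp_solution (R : realType) (a b : R) (rho w : R -> R) (lam : R) :
    Prop :=
  [/\ [lipschitz w x | x in `[a, b]],
      {ae @lebesgue_measure R, forall x, x \in `]a, b[ ->
         derivable w x 1 /\
         w^`()%classic x + lam * w x ^+ 2 = (x^-1 + rho x) * w x},
      w a = 1 &
      w b = 1].

(* Main.v *)
(* Let ]al, be[ be the convex hull of {w > t}.  There w(al) = w(be) = t, so the
   equation gives al w'(al) - be w'(be) = t ((be - al) (lam t - rho(be-))
   - al (rho(be-) - rho(al+))), and testing the linear equation for t / w on
   ]al, be[ against an increasing exponential weight yields the Chebyshev-type
   bound lam t - rho(be-) <= 2 / (al + be), strict when rho(be-) > 0.
   By the inequality between the arithmetic and harmonic means, the end points
   move inwards with t fast enough for t^2 (al + be)^2 / (al be) to be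
   nonincreasing, and strictly decreasing at t = 1 when rho is not zero.
   For rho = 0 the solution is w0(x) = (a + b) x / (x^2 + a b), whose superlevel
   sets are intervals along which this quantity keeps the value
   (a + b)^2 / (a b).  As mu(]al, be[) = ln (be / al) is an increasing function
   of (al + be)^2 / (al be), all the comparisons follow. *)
Require Import Defs.
From mathcomp Require Import all_boot all_order all_algebra.
From mathcomp Require Import all_classical all_reals all_analysis.
From mathcomp Require Import measurable_realfun ring lra.
Import Order.TTheory GRing.Theory Num.Theory numFieldNormedType.Exports.

Set Implicit Arguments.
Unset Strict Implicit.
Unset Printing Implicit Defensive.

Local Open Scope classical_set_scope.
Local Open Scope ring_scope.

(** * Real induction and monotonicity from an almost everywhere derivative *)

(** The supremum of the points of [[a, b]] satisfying [P] satisfies [P] by the last hypothesis, and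
    cannot lie below [b] by the one before it. The last one assumes [P] only at points arbitrarily
    close to [c], since the points satisfying [P] need not form an interval. *)
Lemma real_induction (R : realType) (a b : R) (P : R -> Prop) :
  a <= b -> P a ->
  (forall c, a <= c < b -> P c -> exists2 y, c < y <= b & P y) ->
  (forall c, a < c <= b ->
    (forall e, 0 < e -> exists2 x, a <= x <= c & c - e < x /\ P x) -> P c) ->
  P b.
Proof.
move=> ab Pa Pr Pl.
pose S := [set x | a <= x <= b /\ P x].
have Sa : S a by split=> //; rewrite lexx.
have ubS : ubound S b by move=> x [/andP[_ ->]].
have hS : has_sup S by split; [exists a | exists b].
have sb : sup S <= b by apply: ge_sup => //; exists a.
have sa : a <= sup S by apply: ub_le_sup => //; exists b.
have Ps : P (sup S).
  move: sa; rewrite le_eqVlt => /predU1P[<-//|sa].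
  apply: Pl => [|e e0]; first by rewrite sa.
  have [x Sx sx] := sup_adherent e0 hS.
  have [/andP[ax _] Px] := Sx.
  by exists x => //; rewrite ax; apply: ub_le_sup => //; exists b.
move: sb; rewrite le_eqVlt => /predU1P[<-//|sb].
have [||y /andP[sy yb] Py] := Pr (sup S) => //; first by rewrite sa.
have Sy : S y by split=> //; rewrite yb (le_trans sa) // ltW.
by have := ub_le_sup (ex_intro _ b ubS) Sy; rewrite leNgt sy.
Qed.

Lemma is_derive_right_bound (R : realType) (f : R -> R) (x d e : R) :
  is_derive x 1 f d -> 0 < e ->
  exists2 r, 0 < r & forall h, 0 < h < r -> `|f (x + h) - f x - d * h| <= e * h.
Proof.
move=> [df dE] e0.
have : h^-1 *: ((f \o shift x) (h *: 1) - f x) @[h --> 0^'] --> d.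
  by rewrite -dE; exact: df.
move=> /cvgrPdist_le /(_ e e0) [r /= r0 H].
exists r => // h /andP[h0 hr].
have := H h; rewrite /= sub0r normrN gtr0_norm// => /(_ hr).
rewrite gt_eqF// => /(_ isT).
rewrite /GRing.scale/= mulr1 [h + x]addrC => {}H.
rewrite -(ler_pM2l (_ : 0 < h^-1)) ?invr_gt0// mulrCA mulVf ?gt_eqF// mulr1.
rewrite -[X in X * _](gtr0_norm (_ : 0 < h^-1)) ?invr_gt0// -normrM.
rewrite distrC in H; apply: le_trans H; rewrite le_eqVlt; apply/orP; left; apply/eqP.
by congr `|_|; field; rewrite gt_eqF.
Qed.

Definition lip (R : realType) (a b : R) (f : R -> R) : Prop :=
  exists2 L : R, 0 <= L & forall x y, a <= x <= b -> a <= y <= b ->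
    `|f x - f y| <= L * `|x - y|.

Local Notation mu := lebesgue_measure.

Lemma negligible_point (R : realType) (a : R) :
  (@lebesgue_measure R).-negligible [set a].
Proof. by exists [set a]; split=> //; exact: lebesgue_measure_set1. Qed.

Lemma negligible_open_cover (R : realType) (N : set R) (e : R) :
  (@lebesgue_measure R).-negligible N -> 0 < e ->
  exists U : set R, [/\ open U, N `<=` U, measurable U & (mu U < e%:E)%E].
Proof.
move=> [M [mM M0 NM]] e0.
have Moo : (@lebesgue_measure R M < +oo)%E by rewrite M0 ltry.
have [U [oU MU muU]] := lebesgue_regularity_outer mM Moo e0.
have mU : measurable U by exact: open_measurable.
exists U; split=> //; first exact: subset_trans MU.
have := @measureU2 _ _ _ (@lebesgue_measure R) (U `\` M) M (measurableD mU mM) mM.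
have -> : U `\` M `|` M = U by rewrite setUC setDUK.
by rewrite [X in (_ + X)%E]M0 adde0 => /le_lt_trans; apply.
Qed.

(* At the exceptional points, covered by an open set U of small measure, the
   possible decrease of f is compensated by L * mu (U `&` [a, x]). *)
Lemma lip_ae_nondecreasing (R : realType) (a b : R) (f : R -> R) :
  a <= b -> lip a b f ->
  {ae mu, forall x, x \in `]a, b[ ->
     exists2 d, is_derive x 1 f d & 0 <= d} ->
  f a <= f b.
Proof.
move=> ab [L L0 Lf] aef.

suff H e : 0 < e -> f a <= f b + e * (b - a + L).
  apply/ler_addgt0Pr => e e0.
  have c0 : 0 < b - a + L + 1 by rewrite ltr_wpDl// addr_ge0 ?subr_ge0.
  apply: (le_trans (H (e / (b - a + L + 1)) _)); first by rewrite divr_gt0.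
  rewrite lerD2l -mulrA ger_pMr// mulrC ler_pdivrMr// mul1r.
  by rewrite lerDl.
move=> e0.

(* The point [a] joins the null set because the derivative is controlled inside []a, b[] only,
   whereas the induction also has to leave [a]. *)
have [U [oU NU mU muU]] :=
  negligible_open_cover (negligibleU aef (negligible_point a)) e0.
pose p x := fine (mu (U `&` `[a, x])).
have mUI x : measurable (U `&` `[a, x]) by exact: measurableI.
have le_mu (A B : set R) : measurable A -> measurable B -> A `<=` B ->
    (mu A <= mu B)%E.
  by move=> mA mB; apply: (@le_measure _ _ _ (@lebesgue_measure R)); rewrite inE.
have pfin x : mu (U `&` `[a, x]) \is a fin_num.
  rewrite ge0_fin_numE//; apply: (@le_lt_trans _ _ (mu U)).
    exact: le_mu.
  exact: lt_trans muU (ltry _).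
have p_nd x y : x <= y -> p x <= p y.
  move=> xy; rewrite fine_le//; apply: le_mu => //.
  by apply: setIS; apply: subset_itvl; rewrite bnd_simp.
have p0 : 0 <= p a by rewrite fine_ge0.
have pe : p b <= e.
  by rewrite -lee_fin fineK// (le_trans _ (ltW muU))//; exact: le_mu.
have p_U x y : a <= x -> x <= y -> `]x, y] `<=` U -> p x + (y - x) <= p y.
  move=> ax xy xyU.
  rewrite -lee_fin EFinD !fineK//.
  have -> : ((y - x)%:E = mu `]x, y])%E.
    by rewrite lebesgue_measure_itv /= lte_fin; case: ltgtP xy => // ->; rewrite subrr.
  rewrite -measureU//; [|exact: mUI|].
    apply: le_mu => //; first exact: measurableU.
    move=> z [[Uz /=]|/= xyz]; rewrite in_itv/=.
      by move=> /andP[az zx]; split=> //=; rewrite in_itv /= az (le_trans zx).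
    split; first exact: xyU.
    by move: xyz; rewrite /= !in_itv/= => /andP[xz ->]; rewrite (le_trans ax)// ltW.
  apply/seteqP; split=> // z [[_ /=]]; rewrite !in_itv /= => /andP[_ zx] /andP[].
  by rewrite ltNge zx.
pose P x := f a <= f x + e * (x - a) + L * p x.
suff : P b.
  rewrite /P => /le_trans -> //.
  have : L * p b <= L * e by rewrite ler_wpM2l.
  lra.
apply: (@real_induction _ a b (fun x => P x)) => //.
- by rewrite /P subrr mulr0 addr0 lerDl mulr_ge0.
- move=> c /andP[ac cb] Pc.
  (* Inside [U] the loss [L * (y - c)] is absorbed by the growth of [L * p]; outside [U] the
     derivative is nonnegative and the slack [e] absorbs the first-order error. *)
  have [Uc|NUc] := pselect (U c).
    have /nbhs_ballP[r /= r0 rU] : nbhs c U by apply: open_nbhs_nbhs.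
    exists (Num.min b (c + r / 2)).
      by rewrite lt_min cb ltrDl divr_gt0//= ge_min lexx.
    set y := Num.min _ _.
    have cy : c < y by rewrite lt_min cb ltrDl divr_gt0.
    have yb : y <= b by rewrite ge_min lexx.
    have yr : y <= c + r / 2 by rewrite ge_min lexx orbT.
    have : p c + (y - c) <= p y.
      apply: p_U; [exact: ac|exact: ltW|move=> z /=; rewrite in_itv/= => /andP[cz zy]].
      apply: rU; rewrite /ball/= ltr_distlC; apply/andP; split; lra.
    have : `|f y - f c| <= L * `|y - c|.
      by apply: Lf; rewrite ?ac ?(ltW cb)// yb andbT (le_trans ac)// ltW.
    rewrite (gtr0_norm (_ : 0 < y - c)) ?subr_gt0// ler_norml => /andP[fy _] py.
    apply: (le_trans Pc).
    have : L * (p c + (y - c)) <= L * p y by rewrite ler_wpM2l.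
    have : e * (c - a) <= e * (y - a) by apply: ler_wpM2l; [exact: ltW|lra].
    lra.
  have {}ac : a < c.
    by move: ac; rewrite le_eqVlt => /predU1P[ca|//]; case: NUc; apply: NU; right.
  have [d dc d0] : exists2 d : R, is_derive c 1 f d & 0 <= d.
    apply: contrapT => /= nd; apply: NUc; apply: NU; left => /=.
    by apply: contra_not nd; apply; rewrite in_itv/= ac.
  have [r r0 H] := is_derive_right_bound dc e0.
  exists (Num.min b (c + r / 2)).
    by rewrite lt_min cb ltrDl divr_gt0//= ge_min lexx.
  set y := Num.min _ _.
  have cy : c < y by rewrite lt_min cb ltrDl divr_gt0.
  have yr : y <= c + r / 2 by rewrite ge_min lexx orbT.
  have /H : 0 < y - c < r by apply/andP; split; lra.
  rewrite addrCA subrr addr0 ler_norml => /andP[fy _].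
  have : L * p c <= L * p y by rewrite ler_wpM2l// p_nd// ltW.
  have : 0 <= d * (y - c) by rewrite mulr_ge0// subr_ge0 ltW.
  move: Pc; rewrite /P; lra.
- move=> c /andP[ac cb] H.
  apply/ler_addgt0Pr => h h0.
  have [|x /andP[ax xc] [cx Px]] := H (h / (L + 1)).
    by rewrite divr_gt0// ltr_wpDl.
  apply: (le_trans Px).
  have : L * p x <= L * p c by rewrite ler_wpM2l// p_nd.
  have : e * (x - a) <= e * (c - a) by apply: ler_wpM2l; [exact: ltW|lra].
  have : `|f x - f c| <= L * `|x - c| by apply: Lf; rewrite ?ax ?(le_trans xc)// ltW.
  rewrite (distrC x) [in X in _ * X]ger0_norm ?subr_ge0// ler_norml => /andP[_ fx].
  have : L * (c - x) <= h.
    apply: (@le_trans _ _ (L * (h / (L + 1)))).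
      by rewrite ler_wpM2l//; lra.
    rewrite mulrA ler_pdivrMr ?ltr_wpDl// mulrC.
    by apply: ler_wpM2l; [exact: ltW|lra].
  lra.
Qed.

(** * Closure properties of Lipschitz functions on a segment *)

Section lip_closure.
Variables (R : realType) (a b : R).
Implicit Types f g : R -> R.

Lemma lip_lipschitz f : [lipschitz f x | x in `[a, b]] -> lip a b f.
Proof.
move=> /pinfty_ex_gt0[L L0 Lf]; exists L; first exact: ltW.
by move=> x y xab yab; apply: (Lf (x, y)); split; rewrite /= in_itv.
Qed.

Lemma lip_sub c d f : a <= c -> d <= b -> lip a b f -> lip c d f.
Proof.
move=> ac db [L L0 Lf]; exists L => // x y /andP[cx xd] /andP[cy yd].
by apply: Lf; rewrite ?(le_trans ac)//= (le_trans _ db).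
Qed.

Lemma lip_bounded f : lip a b f ->
  exists2 M : R, 0 <= M & forall x, a <= x <= b -> `|f x| <= M.
Proof.
move=> [L L0 Lf]; have [ab|ba] := leP a b; last first.
  by exists 0 => // x /andP[/le_trans/[apply]]; rewrite leNgt ba.
exists (`|f a| + L * (b - a)) => [|x xab].
  by rewrite addr_ge0// mulr_ge0// subr_ge0.
have := Lf x a xab; rewrite lexx => /(_ ab) H.
have : `|f x| <= `|f x - f a| + `|f a|.
  by rewrite -[in X in X <= _](subrK (f a) (f x)) ler_normD.
move/le_trans; apply; rewrite addrC lerD2l (le_trans H)// ler_wpM2l//.
by case/andP: xab => ax xb; rewrite ger0_norm ?subr_ge0// lerB.
Qed.

Lemma lip_cst (k : R) : lip a b (fun=> k).
Proof. by exists 0 => // x y _ _; rewrite subrr normr0 mul0r. Qed.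

Lemma lip_id : lip a b (fun x => x).
Proof. by exists 1 => // x y _ _; rewrite mul1r. Qed.

Lemma lipD f g : lip a b f -> lip a b g -> lip a b (fun x => f x + g x).
Proof.
move=> [L L0 Lf] [K K0 Kg]; exists (L + K) => [|x y xab yab].
  exact: addr_ge0.
rewrite opprD addrACA mulrDl (le_trans (ler_normD _ _))//.
by rewrite lerD// ?Lf ?Kg.
Qed.

Lemma lipM f g : lip a b f -> lip a b g -> lip a b (fun x => f x * g x).
Proof.
move=> lf lg.
have [A A0 Af] := lip_bounded lf; have [B B0 Bg] := lip_bounded lg.
move: lf lg => [L L0 Lf] [K K0 Kg].
exists (L * B + A * K) => [|x y xab yab].
  by rewrite addr_ge0// mulr_ge0.
have -> : f x * g x - f y * g y = (f x - f y) * g x + f y * (g x - g y) by ring.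
rewrite (le_trans (ler_normD _ _))// !normrM mulrDl lerD//.
  by rewrite mulrAC ler_pM// ?Lf ?Bg.
by rewrite -mulrA ler_pM// ?Kg ?Af.
Qed.

Lemma lipN f : lip a b f -> lip a b (fun x => - f x).
Proof. by move=> [L L0 Lf]; exists L => // x y *; rewrite -opprD normrN Lf. Qed.

Lemma lipB f g : lip a b f -> lip a b g -> lip a b (fun x => f x - g x).
Proof. by move=> lf lg; apply: lipD => //; exact: lipN. Qed.

Lemma lipV f : (forall x, a <= x <= b -> 1 <= f x) -> lip a b f ->
  lip a b (fun x => (f x)^-1).
Proof.
move=> f1 [L L0 Lf]; exists L => // x y xab yab.
have [fx fy] := (f1 x xab, f1 y yab).
have fx0 : 0 < f x := lt_le_trans ltr01 fx.
have fy0 : 0 < f y := lt_le_trans ltr01 fy.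
have -> : (f x)^-1 - (f y)^-1 = (f y - f x) / (f x * f y).
  by field; rewrite !gt_eqF.
rewrite normrM normfV (gtr0_norm (mulr_gt0 fx0 fy0)) distrC.
rewrite ler_pdivrMr ?mulr_gt0// (le_trans (Lf x y xab yab))//.
by rewrite ler_peMr ?mulr_ge0// mulr_ege1.
Qed.

Lemma lip_expR f : lip a b f -> lip a b (fun x => expR (f x)).
Proof.
move=> lf; have [M M0 Mf] := lip_bounded lf; move: lf => [L L0 Lf].
exists (expR M * L) => [|x y]; first by rewrite mulr_ge0// expR_ge0.
have H x' y' : a <= x' <= b -> a <= y' <= b -> f x' <= f y' ->
    `|expR (f x') - expR (f y')| <= expR M * L * `|x' - y'|.
  move=> xab yab fxy; rewrite distrC ger0_norm; last by rewrite subr_ge0 ler_expR.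
  apply: (@le_trans _ _ (expR M * `|f x' - f y'|)); last first.
    by rewrite -mulrA ler_wpM2l ?expR_ge0// Lf.
  rewrite distrC (ger0_norm (_ : 0 <= f y' - f x')) ?subr_ge0//.
  apply: (@le_trans _ _ (expR (f y') * (f y' - f x'))); last first.
    apply: ler_wpM2r; rewrite ?subr_ge0// ler_expR.
    by rewrite (le_trans (ler_norm _))// Mf.
  (* The exponential lies above its tangent at [f y'], the larger of the two values. *)
  have := expR_ge1Dx (f x' - f y').
  rewrite -(ler_pM2l (expR_gt0 (f y'))) -expRD [f y' + _]addrC subrK.
  lra.
move=> xab yab; have [/H|/ltW /H] := leP (f x) (f y); first exact.
by rewrite distrC (distrC y); apply.
Qed.

Lemma lip_continuous f : lip a b f -> {within `[a, b], continuous f}.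
Proof.
move=> [L L0 Lf] ; apply/subspace_continuousP => x /=; rewrite in_itv /= => xab.
apply/cvgrPdist_le => e e0; apply/nbhs_ballP; exists (e / (L + 1)) => /=.
  by rewrite divr_gt0// ltr_wpDl.
move=> y /= xy; rewrite in_itv /= => yab.
rewrite (le_trans (Lf _ _ xab yab))//.
move: xy; rewrite /ball /= ltr_pdivlMr ?ltr_wpDl// => /ltW; apply: le_trans.
by rewrite mulrC ler_wpM2l// lerDl.
Qed.

End lip_closure.

(** * Differentiation rules for functions written pointwise *)

Section pointwise_derivatives.
Variables (R : realType) (x : R) (f g : R -> R) (df dg : R).
Hypotheses (fd : is_derive x 1 f df) (gd : is_derive x 1 g dg).

Lemma is_derive_add : is_derive x 1 (fun y => f y + g y) (df + dg).
Proof. exact: is_deriveD. Qed.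

Lemma is_derive_sub : is_derive x 1 (fun y => f y - g y) (df - dg).
Proof. exact: is_deriveB. Qed.

Lemma is_derive_mul : is_derive x 1 (fun y => f y * g y) (f x * dg + g x * df).
Proof. exact: is_deriveM. Qed.

Lemma is_derive_inv : f x != 0 ->
  is_derive x 1 (fun y => (f y)^-1) (- (f x) ^- 2 * df).
Proof. by move=> fx0; exact: is_deriveV. Qed.

Lemma is_derive_exp : is_derive x 1 (fun y => expR (f y)) (expR (f x) * df).
Proof. by have := @is_derive1_comp _ expR f x _ _ (is_derive_expR (f x)) fd. Qed.

End pointwise_derivatives.

Lemma ae_lebesgueS (R : realType) (P Q : R -> Prop) :
  (forall x, P x -> Q x) ->
  {ae @lebesgue_measure R, forall x, P x} ->
  {ae @lebesgue_measure R, forall x, Q x}.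
Proof.
move=> PQ; apply: (@filterS _ (almost_everywhere (@lebesgue_measure R))).
exact: PQ.
Qed.

(** With [r = be / al] the quotient is [r + 2 + r^-1], which increases for [r >= 1], and passing to
    a subinterval lowers [r]. *)
Lemma ler_spread (R : realType) (al be al' be' : R) :
  0 < al -> al <= al' -> al' <= be' -> be' <= be ->
  (al' + be') ^+ 2 / (al' * be') <= (al + be) ^+ 2 / (al * be).
Proof.
move=> al0 aal ab' bbe.
have al'0 : 0 < al' by lra.
have be'0 : 0 < be' by lra.
have be0 : 0 < be by lra.
rewrite ler_pdivrMr ?mulr_gt0// mulrAC ler_pdivlMr ?mulr_gt0// -subr_ge0.
have -> : (al + be) ^+ 2 * (al' * be') - (al' + be') ^+ 2 * (al * be) =
  (al' * be - al * be') * (be * be' - al * al') by ring.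
have : al * be' <= al' * be by apply: ler_pM; lra.
have : al * al' <= be * be' by apply: ler_pM; lra.
move=> h1 h2; apply: mulr_ge0; lra.
Qed.

(** * Solutions that exceed 1 inside the interval *)

Section bvp.
Variables (R : realType) (a b : R) (rho w : R -> R) (lam : R).
Hypotheses (a_gt0 : 0 < a) (ab : a < b).
Hypothesis rho_ge0 : forall x, x \in `[a, b] -> 0 <= rho x.
Hypothesis rho_nd : {in `[a, b] &, {homo rho : x y / x <= y}}.
Hypothesis w_sol : bvp_solution a b rho w lam.
Hypothesis w_gt1 : forall x, x \in `]a, b[ -> 1 < w x.

Let w_lip : lip a b w.
Proof. by case: w_sol => /lip_lipschitz. Qed.

Let wa : w a = 1. Proof. by case: w_sol. Qed.
Let wb : w b = 1. Proof. by case: w_sol. Qed.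

Lemma bvp_solution_ge1 x : a <= x <= b -> 1 <= w x.
Proof.
case/andP; rewrite le_eqVlt => /predU1P[<-|ax]; first by rewrite wa.
rewrite le_eqVlt => /predU1P[->|xb]; first by rewrite wb.
by rewrite ltW// w_gt1// in_itv/= ax.
Qed.

Let w_gt0 x : a <= x <= b -> 0 < w x.
Proof. by move/bvp_solution_ge1; apply: lt_le_trans. Qed.

Let w_der : {ae mu, forall x, x \in `]a, b[ ->
  is_derive x 1 w (w x * (x^-1 + rho x - lam * w x))}.
Proof.
case: w_sol => _ + _ _; apply: ae_lebesgueS => x /[apply] -[dw wE].
apply: DeriveDef => //; rewrite -derive1E.
have -> : w^`()%classic x = (x^-1 + rho x) * w x - lam * w x ^+ 2.
  by rewrite -wE addrK.
ring.
Qed.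

(* If d x = x * w al / w x - x, then d vanishes at both ends of an interval on
   which w takes equal end values, and rho <= r gives d' + r d >= k x - 1 with
   k = lam * w al - r.  Multiplying by the increasing weight exp (r (x - 1/k))
   only increases the right-hand side, which changes sign at x = 1/k. *)
Let barrier (al k r x : R) : R :=
  (x * w al / w x - x) * expR (r * (x - k^-1)) - (x - al) * (k * (x + al) / 2 - 1).

(** With [E = expR (r * (x - k^-1))] the derivative of [barrier] is [(r - rho x) * (x * w al / w x)
    * E + (k * x - 1) * (E - 1)]. The first summand is nonnegative and [c] bounds the second from
    below; a positive [c] serves for the strict case of [lam_le]. *)
Lemma barrier_growth (al be u v k r c : R) :
  a <= al -> al <= u -> u <= v -> v <= be -> be <= b ->
  k = lam * w al - r -> 0 < k ->
  (forall x, al < x < be -> rho x <= r) ->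
  (forall x, u < x < v -> c <= (k * x - 1) * (expR (r * (x - k^-1)) - 1)) ->
  barrier al k r u + c * (v - u) <= barrier al k r v.
Proof.
move=> aal alu uv vbe beb kE k0 rhor H.
suff : barrier al k r u - c * u <= barrier al k r v - c * v by lra.
have wal : 0 < w al by apply: w_gt0; rewrite aal; lra.
apply: (@lip_ae_nondecreasing _ u v (fun x => barrier al k r x - c * x)) => //.
  apply: (@lip_sub _ a b); [lra..|].
  apply: lipB; last by apply: lipM; [exact: lip_cst|exact: lip_id].
  apply: lipB; apply: lipM.
  - apply: lipB; last exact: lip_id.
    by apply: lipM; [apply: lipM; [exact: lip_id|exact: lip_cst]|exact: (lipV bvp_solution_ge1)].
  - apply: lip_expR; apply: lipM; [exact: lip_cst|].
    by apply: lipB; [exact: lip_id|exact: lip_cst].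
  - by apply: lipB; [exact: lip_id|exact: lip_cst].
  - apply: lipB; last exact: lip_cst.
    apply: lipM; last exact: lip_cst.
    by apply: lipM; [exact: lip_cst|apply: lipD; [exact: lip_id|exact: lip_cst]].
move: w_der; apply: ae_lebesgueS => x dw; rewrite in_itv/= => /andP[ux xv].
have {}dw := dw _; rewrite in_itv/= in dw.
have xab : a < x < b by apply/andP; split; lra.
have {}dw := dw xab.
have wx0 : 0 < w x by apply: w_gt0; lra.
have ax : a < x by lra.
have x0 : 0 < x by exact: lt_trans ax.
have did : is_derive x 1 (fun y : R => y) 1 := is_derive_id _ _.
have dcst (z : R) : is_derive x 1 (fun=> z) 0 := is_derive_cst _ _ _.
have wxN0 : w x != 0 by rewrite gt_eqF.
have := is_derive_sub (is_derive_sub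
  (is_derive_mul
    (is_derive_sub (is_derive_mul (is_derive_mul did (dcst (w al)))
      (is_derive_inv dw wxN0)) did)
    (is_derive_exp (is_derive_mul (dcst r) (is_derive_sub did (dcst k^-1)))))
  (is_derive_mul (is_derive_sub did (dcst al))
    (is_derive_sub (is_derive_mul (is_derive_mul (dcst k) (is_derive_add did (dcst al)))
      (dcst 2^-1)) (dcst 1)))) (is_derive_mul (dcst c) did).
set d := (X in is_derive _ _ _ X) => dPhi.
exists d; first exact: dPhi.
have cH := H x; rewrite ux xv in cH; have {}cH := cH isT.
have rx : rho x <= r by apply: rhor; lra.
set E := expR _ in cH *.
have E0 : 0 < E by exact: expR_gt0.
have Hq : 0 <= (r - rho x) * (x * w al / w x) * E.
  apply: mulr_ge0; last exact: ltW.
  by apply: mulr_ge0; [rewrite subr_ge0|rewrite ltW// divr_gt0// mulr_gt0].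
have -> : d = (r - rho x) * (x * w al / w x) * E + (k * x - 1) * (E - 1) - c.
  have lamE : lam = (k + r) / w al by rewrite kE subrK mulfK// gt_eqF.
  by rewrite /d -/E lamE; field; rewrite !gt_eqF.
lra.
Qed.

(** For [k > 0], [barrier] is nondecreasing, vanishes at [al] and equals
    [- ((be - al) * (k * (be + al) / 2 - 1))] at [be], so the last factor cannot be positive. In the
    application [r] is the left limit of [rho] at [be]. *)
Lemma lam_le (al be r : R) : a <= al -> al < be -> be <= b -> w al = w be ->
  0 <= r -> (forall x, al < x < be -> rho x <= r) ->
  (lam * w al - r) * (al + be) <= 2 /\
  (0 < r -> (lam * w al - r) * (al + be) < 2).
Proof.
move=> aal albe beb wE r0 rhor; set k := lam * w al - r.
have al0 : 0 < al by apply: lt_le_trans aal.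
have [k0|k0] := leP k 0.
  by split; [|move=> _]; nra.
have wbe : w be / w be = 1 by rewrite divff// gt_eqF// w_gt0//; lra.
have bal : barrier al k r al = 0.
  by rewrite /barrier subrr mul0r subr0 -mulrA wE wbe mulr1 subrr mul0r.
have bbe : barrier al k r be = - ((be - al) * (k * (be + al) / 2 - 1)).
  by rewrite /barrier -mulrA wE wbe mulr1 subrr mul0r sub0r.
have kV : k * k^-1 = 1 by rewrite divff// gt_eqF.
(* Both factors change sign at [k^-1], in the same direction. *)
have g_ge0 x : 0 <= (k * x - 1) * (expR (r * (x - k^-1)) - 1).
  have -> : k * x - 1 = k * (x - k^-1) by rewrite mulrBr kV.
  have [xk|xk] := leP x k^-1.
    apply: mulr_le0; first by nra.
    by rewrite subr_le0 -expR0 ler_expR; nra.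
  apply: mulr_ge0; first by nra.
  by rewrite subr_ge0 -expR0 ler_expR; nra.
have grow u v : al <= u -> u <= v -> v <= be ->
    barrier al k r u <= barrier al k r v.
  move=> alu uv vbe; have := @barrier_growth al be u v k r 0.
  by rewrite mul0r addr0; apply.
have le2 : k * (al + be) <= 2.
  have := grow al be (lexx _) (ltW albe) (lexx _).
  rewrite bal bbe; nra.
split=> // r_gt0; rewrite lt_neqAle le2 andbT; apply/eqP => k2.
(* Equality would put [k^-1] at the midpoint and make [barrier] vanish at both ends, although it
   grows at a positive rate on the last quarter [[y, be]]. *)
have kE : k^-1 = (al + be) / 2.
  have : k^-1 * (k * (al + be)) = k^-1 * 2 by rewrite k2.
  rewrite mulrA (mulrC _ k) kV; lra.
set y := ((al + be) / 2 + be) / 2.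
have yk : k^-1 < y by rewrite kE /y; lra.
have ybe : y < be by rewrite /y; lra.
have aly : al < y by rewrite /y; lra.
set c := (k * y - 1) * (expR (r * (y - k^-1)) - 1).
have c0 : 0 < c.
  have -> : c = k * (y - k^-1) * (expR (r * (y - k^-1)) - 1).
    by rewrite /c (mulrBr k y) kV.
  apply: mulr_gt0; first by rewrite mulr_gt0// subr_gt0.
  by rewrite subr_gt0 -expR0 ltr_expR mulr_gt0// subr_gt0.
have := @barrier_growth al be y be k r c aal (ltW aly) (ltW ybe) (lexx _) beb
  erefl k0 rhor.
have H x : y < x < be -> c <= (k * x - 1) * (expR (r * (x - k^-1)) - 1).
  move=> /andP[yx xbe]; apply: ler_pM.
  - by have := mulVf; nra.
  - by rewrite subr_ge0 -expR0 ler_expR; nra.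
  - by nra.
  - by rewrite lerD2r ler_expR; nra.
move=> /(_ H); have := grow al y (lexx _) (ltW aly) (ltW ybe).
rewrite bal bbe; have : 0 < c * (be - y) by rewrite mulr_gt0// subr_gt0.
nra.
Qed.

(** * One-sided slopes and end points of the superlevel sets *)

(** The equation gives [w' <= h], where [h] replaces [x^-1] and [rho] by their upper bounds [al^-1]
    and [r]. As [h] is Lipschitz and [h al < k], the slope stays below [k] on a short interval. *)
Lemma slope_right (al y r k : R) : a <= al -> al < y -> y <= b ->
  (forall x, al < x < y -> rho x <= r) ->
  w al * (al^-1 + r - lam * w al) < k ->
  exists2 d, 0 < d & forall x, al <= x -> x < al + d -> x <= b ->
    w x <= w al + k * (x - al).
Proof.
move=> aal aly yb rhor kD.
have al0 : 0 < al by apply: lt_le_trans aal.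
pose h x := w x * (al^-1 + r - lam * w x).
have [L L0 Lh] : lip a b h.
  apply: lipM => //; apply: lipB; first exact: lip_cst.
  by apply: lipM => //; exact: lip_cst.
have albab : a <= al <= b by rewrite aal; lra.
pose d := Num.min (y - al) ((k - h al) / (L + 1)).
have dh : d <= (k - h al) / (L + 1) by rewrite ge_min lexx orbT.
have dy : d <= y - al by rewrite ge_min lexx.
have L1 : 0 < L + 1 by lra.
have d0 : 0 < d by rewrite lt_min subr_gt0 aly divr_gt0// subr_gt0.
exists d => // x alx xd xb.
suff : k * al - w al <= k * x - w x by lra.
apply: (@lip_ae_nondecreasing _ al x (fun x => k * x - w x)) => //.
  apply: (@lip_sub _ a b) => //; apply: lipB => //.
  by apply: lipM; [exact: lip_cst|exact: lip_id].
move: w_der; apply: ae_lebesgueS => z dw; rewrite in_itv/= => /andP[alz zx].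
have zab : a < z < b by apply/andP; split; lra.
have {}dw := dw _; rewrite in_itv/= in dw; have {}dw := dw zab.
have := is_derive_sub (is_derive_mul (is_derive_cst k z 1) (is_derive_id z 1)) dw.
set e := (X in is_derive _ _ _ X) => de; exists e; first exact: de.
have wz0 : 0 < w z by apply: w_gt0; lra.
have rz : rho z <= r by apply: rhor; lra.
have zal : z^-1 <= al^-1 by rewrite lef_pV2 ?posrE//; lra.
have : `|h z - h al| <= L * `|z - al| by apply: Lh; lra.
rewrite (gtr0_norm (_ : 0 < z - al)) ?subr_gt0// ler_norml => /andP[_ hz].
have : (L + 1) * (z - al) <= k - h al by rewrite mulrC -ler_pdivlMr//; lra.
have : 0 <= w z * (al^-1 - z^-1 + (r - rho z)) by rewrite mulr_ge0//; lra.
rewrite /e /= /cst /h in hz *; lra.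
Qed.

(** Mirror image of [slope_right]: [- w'] is bounded through the lower bounds [be^-1] and [r]. *)
Lemma slope_left (be y r k : R) : a <= y -> y < be -> be <= b ->
  (forall x, y < x < be -> r <= rho x) ->
  w be * (lam * w be - be^-1 - r) < k ->
  exists2 d, 0 < d & forall x, x <= be -> be - d < x -> a <= x ->
    w x <= w be + k * (be - x).
Proof.
move=> ay ybe beb rhor kD.
have be0 : 0 < be by rewrite (lt_trans a_gt0)// (le_lt_trans ay).
pose h x := w x * (lam * w x - be^-1 - r).
have [L L0 Lh] : lip a b h.
  apply: lipM => //; apply: lipB; last exact: lip_cst.
  apply: lipB; last exact: lip_cst.
  by apply: lipM => //; exact: lip_cst.
have beab : a <= be <= b by rewrite beb andbT; lra.
pose d := Num.min (be - y) ((k - h be) / (L + 1)).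
have dh : d <= (k - h be) / (L + 1) by rewrite ge_min lexx orbT.
have dy : d <= be - y by rewrite ge_min lexx.
have L1 : 0 < L + 1 by lra.
have d0 : 0 < d by rewrite lt_min subr_gt0 ybe divr_gt0// subr_gt0.
exists d => // x xbe xd ax.
suff : k * x + w x <= k * be + w be by lra.
apply: (@lip_ae_nondecreasing _ x be (fun x => k * x + w x)) => //.
  apply: (@lip_sub _ a b) => //; apply: lipD => //.
  by apply: lipM; [exact: lip_cst|exact: lip_id].
move: w_der; apply: ae_lebesgueS => z dw; rewrite in_itv/= => /andP[xz zbe].
have az : a < z by lra.
have zab : a < z < b by apply/andP; split; lra.
have {}dw := dw _; rewrite in_itv/= in dw; have {}dw := dw zab.
have := is_derive_add (is_derive_mul (is_derive_cst k z 1) (is_derive_id z 1)) dw.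
set e := (X in is_derive _ _ _ X) => de; exists e; first exact: de.
have wz0 : 0 < w z by apply: w_gt0; lra.
have rz : r <= rho z by apply: rhor; lra.
have z0 : 0 < z by exact: lt_trans az.
have zbeV : be^-1 <= z^-1 by rewrite lef_pV2 ?posrE//; lra.
have : `|h z - h be| <= L * `|z - be| by apply: Lh; lra.
rewrite distrC (distrC z) (gtr0_norm (_ : 0 < be - z)) ?subr_gt0// ler_norml.
move=> /andP[hz _].
have : (L + 1) * (be - z) <= k - h be by rewrite mulrC -ler_pdivlMr//; lra.
have : 0 <= w z * (z^-1 - be^-1 + (rho z - r)) by rewrite mulr_ge0//; lra.
rewrite /e /= /cst /h in hz *; lra.
Qed.

(* The end points of the convex hull of the superlevel set, which need not be
   an interval. *)
Definition super_level (t : R) := [set x | a <= x <= b /\ t < w x].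
Definition left_end (t : R) := inf (super_level t).
Definition right_end (t : R) := sup (super_level t).

(** All follows from continuity. If [w] exceeded [t] at an end, this end would differ from [a] and
    [b], where [w] is 1, and the set would extend past it; if [w] were below [t] there, the set
    would keep away from it. *)
Lemma super_level_ends (t : R) : 1 <= t -> super_level t !=set0 ->
  [/\ [/\ a <= left_end t, left_end t < right_end t & right_end t <= b],
      w (left_end t) = t, w (right_end t) = t,
      forall x, super_level t x -> left_end t < x < right_end t &
      forall d, 0 < d ->
        (exists2 x, super_level t x & x < left_end t + d) /\
        (exists2 x, super_level t x & right_end t - d < x)].
Proof.
move=> t1 [x0 Sx0].
have hi : has_inf (super_level t).
  by split; [exists x0|exists a => x [/andP[]]].
have hs : has_sup (super_level t).
  by split; [exists x0|exists b => x [/andP[]]].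
set al := left_end t; set be := right_end t.
have lal x : super_level t x -> al <= x.
  by move=> Sx; apply: ge_inf => //; case: hi.
have lbe x : super_level t x -> x <= be.
  by move=> Sx; apply: ub_le_sup => //; case: hs.
have aal : a <= al by apply: lb_le_inf; [exists x0|move=> x [/andP[]]].
have beb : be <= b by apply: ge_sup; [exists x0|move=> x [/andP[]]].
have nal (d : R) : 0 < d -> exists2 x, super_level t x & x < al + d.
  by move=> d0; have [x] := inf_adherent d0 hi; exists x.
have nbe (d : R) : 0 < d -> exists2 x, super_level t x & be - d < x.
  by move=> d0; have [x] := sup_adherent d0 hs; exists x.
have albe : al <= be by rewrite (le_trans (lal _ Sx0))// lbe.
have alab : a <= al <= b by rewrite aal (le_trans albe).
have beab : a <= be <= b by rewrite beb (le_trans aal).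
have [L L0 Lw] := w_lip.
have near (p u v : R) : a <= p <= b -> u < v -> exists2 e : R, 0 < e &
    forall x, a <= x <= b -> `|x - p| < e -> `|w x - w p| < v - u.
  move=> pab uv; exists ((v - u) / (L + 1)); first by apply: divr_gt0; lra.
  move=> x xab; rewrite ltr_pdivlMr; last lra.
  move=> xp; apply: le_lt_trans (Lw x p xab pab) _.
  have := normr_ge0 (x - p); lra.
have wal : w al = t.
  apply/eqP; rewrite eq_le !leNgt; apply/andP; split; apply/negP => wt.
    have {}aal : a < al.
      rewrite lt_neqAle aal andbT; apply/eqP => alE; move: wt; rewrite -alE wa; lra.
    have [e e0 H] := near al t (w al) alab wt.
    pose x := Num.max a (al - e / 2).
    have xal : x < al by rewrite gt_max aal; lra.
    have ax : a <= x by rewrite le_max lexx.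
    have xe : al - e / 2 <= x by rewrite le_max lexx orbT.
    have xab : a <= x <= b by rewrite ax (le_trans (ltW xal))//; case/andP: alab.
    have /H : `|x - al| < e by rewrite ltr_norml; lra.
    rewrite xab => /(_ isT); rewrite ltr_norml => /andP[wx _].
    suff /lal : super_level t x by lra.
    by split=> //; lra.
  have [e e0 H] := near al (w al) t alab wt.
  have [x Sx xe] := nal _ e0.
  have [xab tx] := Sx; have alx := lal _ Sx.
  have := H x xab; rewrite ger0_norm ?subr_ge0// => H'.
  have {}H' : `|w x - w al| < t - w al by apply: H'; lra.
  have := ler_norm (w x - w al); lra.
have wbe : w be = t.
  apply/eqP; rewrite eq_le !leNgt; apply/andP; split; apply/negP => wt.
    have {}beb : be < b.
      rewrite lt_neqAle beb andbT; apply/eqP => beE; move: wt; rewrite beE wb; lra.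
    have [e e0 H] := near be t (w be) beab wt.
    pose x := Num.min b (be + e / 2).
    have xbe : be < x by rewrite lt_min beb; lra.
    have xb : x <= b by rewrite ge_min lexx.
    have xe : x <= be + e / 2 by rewrite ge_min lexx orbT.
    have xab : a <= x <= b by rewrite xb andbT (le_trans _ (ltW xbe))//; case/andP: beab.
    have /H : `|x - be| < e by rewrite ltr_norml; lra.
    rewrite xab => /(_ isT); rewrite ltr_norml => /andP[wx _].
    suff /lbe : super_level t x by lra.
    by split=> //; lra.
  have [e e0 H] := near be (w be) t beab wt.
  have [x Sx xe] := nbe _ e0.
  have [xab tx] := Sx; have xbe := lbe _ Sx.
  have := H x xab; rewrite distrC ger0_norm ?subr_ge0// => H'.
  have {}H' : `|w x - w be| < t - w be by apply: H'; lra.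
  have := ler_norm (w x - w be); lra.
have lt_ends x : super_level t x -> al < x < be.
  move=> Sx; have [_ tx] := Sx; rewrite !lt_neqAle lal// lbe// !andbT.
  by apply/andP; split; apply/eqP => xE; move: tx; rewrite -?xE ?wal ?xE ?wbe ltxx.
split=> //.
  split=> //; have /andP[] := lt_ends _ Sx0; exact: lt_trans.
by move=> d d0; split; [exact: nal|exact: nbe].
Qed.

(* For the solution with rho = 0 this quantity does not depend on t; for w it is
   nonincreasing in t. *)
Definition spread (t : R) : R :=
  t ^+ 2 * (left_end t + right_end t) ^+ 2 / (left_end t * right_end t).

Let rho_homo x y : a <= x -> x <= y -> y <= b -> rho x <= rho y.
Proof.
move=> ax xy yb; apply: rho_nd => //; rewrite in_itv/=; first by rewrite ax (le_trans xy).
by rewrite yb (le_trans ax).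
Qed.

(** * Motion of the end points as the level rises *)

Section step.
Variables (t rp rm : R).
Hypotheses (t1 : 1 <= t) (St : super_level t !=set0).
Local Notation al := (left_end t).
Local Notation be := (right_end t).
(* rp and rm stand for the one-sided limits rho(al+) and rho(be-); D and D' are
   then the one-sided slopes w'(al+) and - w'(be-). *)
Hypothesis rhop : forall d : R, 0 < d -> exists2 y : R, al < y < be & rho y < rp + d.
Hypothesis rhom : forall d : R, 0 < d -> exists2 y : R, al < y < be & rm - d < rho y.
Let D := t * (al^-1 + rp - lam * t).
Let D' := t * (lam * t - be^-1 - rm).

Let t0 : 0 < t := lt_le_trans ltr01 t1.

Let left_slope k : D < k -> exists2 d : R, 0 < d &
  forall x : R, al <= x -> x < al + d -> x <= b -> w x <= t + k * (x - al).
Proof.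
move=> Dk; have [[aal albe beb] wal _ _ _] := super_level_ends t1 St.
(* With this tolerance, replacing [rp] by [rho y] in [D] keeps the slope below [k]. *)
have d0 : 0 < (k - D) / t by apply: divr_gt0; rewrite ?subr_gt0.
have [y /andP[aly ybe] ry] := rhop d0.
have := @slope_right al y (rho y) k aal aly.
rewrite wal; apply; first by lra.
  by move=> x /andP[alx xy]; apply: rho_homo; lra.
move: ry; rewrite -ltrBlDl ltr_pdivlMr//.
rewrite /D; lra.
Qed.

Let right_slope k : D' < k -> exists2 d : R, 0 < d &
  forall x : R, x <= be -> be - d < x -> a <= x -> w x <= t + k * (be - x).
Proof.
move=> Dk; have [[aal albe beb] _ wbe _ _] := super_level_ends t1 St.
have d0 : 0 < (k - D') / t by apply: divr_gt0; rewrite ?subr_gt0.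
have [y /andP[aly ybe] ry] := rhom d0.
have := @slope_left be y (rho y) k _ ybe beb.
rewrite wbe; apply; first by lra.
  by move=> x /andP[alx xy]; apply: rho_homo; lra.
move: ry; rewrite ltrBlDr -ltrBlDl ltr_pdivlMr//.
rewrite /D'; lra.
Qed.

(** Otherwise the slope bound with [k = 0] would keep [w <= t] just to the right of [al], where the
    superlevel set accumulates. *)
Lemma left_slope_ge0 : 0 <= D.
Proof.
rewrite leNgt; apply/negP => /left_slope[d d0 H].
have [_ _ _ Slt Snear] := super_level_ends t1 St.
have [[x Sx xd] _] := Snear d d0.
have [/andP[_ xb] tx] := Sx.
have /andP[alx _] := Slt _ Sx.
have := H x (ltW alx) xd xb; lra.
Qed.

Lemma right_slope_ge0 : 0 <= D'.
Proof.
rewrite leNgt; apply/negP => /right_slope[d d0 H].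
have [_ _ _ Slt Snear] := super_level_ends t1 St.
have [_ [x Sx xd]] := Snear d d0.
have [/andP[ax _] tx] := Sx.
have /andP[_ xbe] := Slt _ Sx.
have := H x (ltW xbe) xd ax; lra.
Qed.

(** Climbing from [t] at rate at most [k], [w] needs a length of at least [h / k] to exceed
    [t + h]. *)
Let left_step k : D < k -> exists2 d : R, 0 < d & forall h : R, 0 < h < d ->
  super_level (t + h) !=set0 -> al + h / k <= left_end (t + h).
Proof.
move=> Dk; have [d d0 H] := left_slope Dk.
have k0 : 0 < k by exact: le_lt_trans left_slope_ge0 Dk.
have [_ _ _ Slt _] := super_level_ends t1 St.
exists (d * k) => [|h /andP[h0 hd] [z Sz]]; first exact: mulr_gt0.
apply: lb_le_inf; first by exists z.
move=> x [/andP[ax xb] thx].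
have Sx : super_level t x by split; [rewrite ax|lra].
have /andP[alx _] := Slt _ Sx.
rewrite leNgt; apply/negP => xh.
have hk : h / k < d by rewrite ltr_pdivrMr.
have := H x (ltW alx) (lt_trans xh (ler_ltD (lexx _) hk)) xb.
have : k * (x - al) < h by rewrite mulrC -ltr_pdivlMr//; lra.
lra.
Qed.

Let right_step k : D' < k -> exists2 d : R, 0 < d & forall h : R, 0 < h < d ->
  super_level (t + h) !=set0 -> right_end (t + h) <= be - h / k.
Proof.
move=> Dk; have [d d0 H] := right_slope Dk.
have k0 : 0 < k by exact: le_lt_trans right_slope_ge0 Dk.
have [_ _ _ Slt _] := super_level_ends t1 St.
exists (d * k) => [|h /andP[h0 hd] [z Sz]]; first exact: mulr_gt0.
apply: ge_sup; first by exists z.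
move=> x [/andP[ax xb] thx].
have Sx : super_level t x by split; [rewrite ax|lra].
have /andP[_ xbe] := Slt _ Sx.
rewrite leNgt; apply/negP => xh.
have hk : h / k < d by rewrite ltr_pdivrMr.
have := H x (ltW xbe) _ ax.
have : k * (be - x) < h by rewrite mulrC -ltr_pdivlMr//; lra.
move=> kh; have -> : be - d < x by lra.
move=> /(_ isT); lra.
Qed.

(** By [ler_spread] it suffices to follow the explicit interval []A, B[], whose ends move inwards at
    the rates [1 / (D + eta)] and [1 / (D' + eta)]. The hypothesis says that its spread grows at a
    rate below [e], once [1 / x + 1 / y] has been estimated by [4 / (x + y)] and [eta] neglected. *)
Lemma spread_step e :
  (2 * t * (al + be) ^+ 2 - e * (al * be)) * (al * D + be * D') <
    4 * t ^+ 2 * (be ^+ 2 - al ^+ 2) ->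
  exists2 d : R, 0 < d & forall h : R, 0 < h < d -> super_level (t + h) !=set0 ->
    spread (t + h) < spread t + e * h.
Proof.
have [[aal albe beb] _ _ _ _] := super_level_ends t1 St.
have al0 : 0 < al by apply: lt_le_trans aal.
have be0 : 0 < be by apply: lt_trans albe.
have [D0 D'0] := (left_slope_ge0, right_slope_ge0).
set X := _ - e * _; set Y := 4 * _ * _; set S := al * D + be * D' => XY.
have s0 : 0 < al + be by lra.
(* [eta] makes both slopes positive even if [D] or [D'] is 0, and uses up at most half of the gap
   [Y - X * S]. *)
have [eta eta0 XYeta] : exists2 eta : R, 0 < eta & X * (S + eta * (al + be)) < Y.
  exists ((Y - X * S) / (2 * (`|X| + 1) * (al + be))).
    rewrite divr_gt0 ?subr_gt0// mulr_gt0// mulr_gt0// ltr_wpDl//.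
  have X1 : 0 < `|X| + 1 by rewrite ltr_wpDl.
  have -> : X * (S + (Y - X * S) / (2 * (`|X| + 1) * (al + be)) * (al + be)) =
    X * S + X / (`|X| + 1) * ((Y - X * S) / 2).
    by field; rewrite !gt_eqF.
  suff : X / (`|X| + 1) * ((Y - X * S) / 2) <= (Y - X * S) / 2 by lra.
  rewrite ger_pMl; last by lra.
  rewrite ler_pdivrMr// mul1r.
  have := ler_norm X; lra.
pose k := D + eta; pose k' := D' + eta.
have k0 : 0 < k by rewrite ltr_wpDl.
have k'0 : 0 < k' by rewrite ltr_wpDl.
have [|d1 d10 H1] := @left_step k; first by rewrite ltrDl.
have [|d2 d20 H2] := @right_step k'; first by rewrite ltrDl.
pose u := k^-1; pose v := k'^-1.
have u0 : 0 < u by rewrite invr_gt0.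
have v0 : 0 < v by rewrite invr_gt0.
pose F := spread t.
have FE : F * (al * be) = (t * (al + be)) ^+ 2.
  by rewrite /F /spread; field; rewrite !gt_eqF.
(* [q] is the derivative at 0 of [Q] below, and [Q 0 = 0]. Positivity of [Q h] says that []A, B[] at
   level [t + h] has spread below [spread t + e * h]. *)
pose q := e * (al * be) + F * (u * be - v * al) -
  2 * (t * (al + be)) * (al + be + t * (u - v)).
have q0 : 0 < q.
  have qE : q = t ^+ 2 * (be ^+ 2 - al ^+ 2) * (u / al + v / be) - X.
    rewrite /q /X /F /spread; field; rewrite !gt_eqF//.
  have S0 : 0 < S + eta * (al + be).
    apply: ltr_wpDl; last exact: mulr_gt0.
    by apply: addr_ge0; apply: mulr_ge0 => //; exact: ltW.
  (* 1 / x + 1 / y >= 4 / (x + y) with x = al * k and y = be * k' *)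
  have amhm : 4 <= (u / al + v / be) * (S + eta * (al + be)).
    have -> : S + eta * (al + be) = al * k + be * k' by rewrite /S /k /k'; ring.
    set x := al * k; set y := be * k'.
    have x0 : 0 < x by rewrite mulr_gt0.
    have y0 : 0 < y by rewrite mulr_gt0.
    have -> : u / al + v / be = (x + y) / (x * y).
      by rewrite /x /y /u /v; field; rewrite !gt_eqF.
    rewrite mulrAC ler_pdivlMr ?mulr_gt0//.
    have := sqr_ge0 (x - y); nra.
  rewrite qE subr_gt0 -(ltr_pM2r S0) (lt_le_trans XYeta)//.
  rewrite -[X in _ <= X]mulrA /Y.
  rewrite (_ : 4 * _ * _ = t ^+ 2 * (be ^+ 2 - al ^+ 2) * 4); last by ring.
  rewrite ler_wpM2l// mulr_ge0 ?sqr_ge0// subr_ge0 ler_sqr ?nnegrE; exact: ltW.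
pose Q h := (F + e * h) * ((al + h * u) * (be - h * v)) -
  ((t + h) * (al + h * u + (be - h * v))) ^+ 2.
have [d3 d30 H3] : exists2 d : R, 0 < d & forall h : R, 0 < h < d -> 0 < Q h.
  have dQ : is_derive (0 : R) 1 Q q.
    have did : is_derive (0 : R) 1 (fun y : R => y) 1 := is_derive_id _ _.
    have dcst (z : R) : is_derive (0 : R) 1 (fun=> z) 0 := is_derive_cst _ _ _.
    have dA := is_derive_add (dcst al) (is_derive_mul did (dcst u)).
    have dB := is_derive_sub (dcst be) (is_derive_mul did (dcst v)).
    have dG := is_derive_mul (is_derive_add (dcst t) did) (is_derive_add dA dB).
    have := is_derive_sub (is_derive_mul
      (is_derive_add (dcst F) (is_derive_mul (dcst e) did))
      (is_derive_mul dA dB)) (is_derive_mul dG dG).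
    set q' := (X in is_derive _ _ _ X) => dQ.
    have -> : q = q' by rewrite /q /q'; ring.
    exact: dQ.
  have q20 : 0 < q / 2 by rewrite divr_gt0.
  have [d d0 H] := is_derive_right_bound dQ q20.
  exists d => // h hd; have := H h hd.
  have -> : Q 0 = 0 by rewrite /Q !mulr0 !mul0r !addr0 !subr0 FE subrr.
  rewrite add0r subr0 ler_norml => /andP[+ _].
  case/andP: hd => h0 _; have : 0 < q * h by rewrite mulr_gt0.
  lra.
exists (Num.min d1 (Num.min d2 d3)); first by rewrite !lt_min d10 d20.
move=> h /andP[h0]; rewrite !lt_min => /and3P[hd1 hd2 hd3] Sh.
have := H1 h; rewrite h0 hd1 => /(_ isT Sh) lal.
have := H2 h; rewrite h0 hd2 => /(_ isT Sh) lbe.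
have := H3 h; rewrite h0 hd3 => /(_ isT); rewrite /Q -/u -/v subr_gt0 => Qh.
have [|[_ lalbe _] _ _ _ _] := super_level_ends _ Sh; first by have := t1; lra.
set al' := left_end (t + h) in lal lalbe; set be' := right_end (t + h) in lbe lalbe.
set A := al + h * u in Qh lal; set B := be - h * v in Qh lbe.
have A0 : 0 < A by rewrite addr_gt0// mulr_gt0.
have B0 : 0 < B by lra.
have := ler_spread A0 lal (ltW lalbe) lbe.
rewrite -(ler_pM2l (_ : 0 < (t + h) ^+ 2)); last by rewrite exprn_gt0// addr_gt0.
rewrite /spread -/al' -/be' -mulrA => /le_lt_trans; apply.
by rewrite mulrA ltr_pdivrMr ?mulr_gt0// -exprMn.
Qed.

End step.

(** * Monotonicity of the spread in the level *)

(** The witnesses are the infimum and supremum of [rho] on []al, be[], which by monotonicity are its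
    one-sided limits. *)
Lemma one_sided_limits al be : a <= al -> al < be -> be <= b ->
  exists rp rm, [/\ forall d : R, 0 < d -> exists2 y : R, al < y < be & rho y < rp + d,
    forall d : R, 0 < d -> exists2 y : R, al < y < be & rm - d < rho y &
    forall x, al < x < be -> [/\ 0 <= rho x, rp <= rho x & rho x <= rm]].
Proof.
move=> aal albe beb.
pose A := [set rho x | x in [set x | al < x < be]].
have A0 : A !=set0 by exists (rho ((al + be) / 2)), ((al + be) / 2) => //=; lra.
have rho0 x : al < x < be -> 0 <= rho x.
  by move=> /andP[alx xbe]; apply: rho_ge0; rewrite in_itv/=; lra.
have rhob x : al < x < be -> rho x <= rho b.
  by move=> /andP[alx xbe]; apply: rho_homo; lra.
have lA : has_lbound A by exists 0 => _ [x /rho0 ? <-].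
have uA : has_ubound A by exists (rho b) => _ [x /rhob ? <-].
exists (inf A), (sup A); split=> [d d0|d d0|x xab].
- by have [_ [y yab <-]] := inf_adherent d0 (conj A0 lA); exists y.
- by have [_ [y yab <-]] := sup_adherent d0 (conj A0 uA); exists y.
- split; [exact: rho0|by apply: ge_inf => //; exists x|].
  by apply: ub_le_sup => //; exists x.
Qed.

Let super_level_le s t : s <= t -> super_level t `<=` super_level s.
Proof. by move=> st x [xab /(le_lt_trans st)]. Qed.

(** The convex hulls are nested, so [spread t / t ^+ 2] is nonincreasing. This crude bound excludes
    an upward jump of [spread] at a level approached from below, about which [spread_step] says
    nothing. *)
Lemma spread_le s t : 1 <= s -> s <= t -> super_level t !=set0 ->
  spread t * s ^+ 2 <= t ^+ 2 * spread s.
Proof.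
move=> s1 st St.
have Ss : super_level s !=set0 by case: St => x /(super_level_le st); exists x.
have [[aal albe beb] _ _ _ _] := super_level_ends s1 Ss.
have [[aal' albe' beb'] _ _ _ _] := super_level_ends (le_trans s1 st) St.
have al0 : 0 < left_end s by apply: lt_le_trans aal.
have lal : left_end s <= left_end t.
  apply: lb_le_inf => // x /(super_level_le st) Sx.
  by apply: ge_inf => //; exists a => z [/andP[]].
have lbe : right_end t <= right_end s.
  apply: ge_sup => // x /(super_level_le st) Sx.
  by apply: ub_le_sup => //; exists b => z [/andP[]].
have := ler_spread al0 lal (ltW albe') lbe.
rewrite /spread; set P := _ / _; set Q := _ / _ => PQ.
rewrite -[t ^+ 2 * _ / _]mulrA -[s ^+ 2 * _ / _]mulrA -/P -/Q.
rewrite mulrAC -mulrA [t ^+ 2 * (s ^+ 2 * Q)]mulrA [t ^+ 2 * (s ^+ 2 * P)]mulrA.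
by rewrite ler_wpM2l// mulr_ge0 ?sqr_ge0.
Qed.

Lemma spread_ge0 t : 1 <= t -> super_level t !=set0 -> 0 <= spread t.
Proof.
move=> t1 St; have [[aal albe beb] _ _ _ _] := super_level_ends t1 St.
have al0 : 0 < left_end t by apply: lt_le_trans aal.
have be0 : 0 < right_end t by exact: lt_trans albe.
by apply: divr_ge0; [rewrite mulr_ge0 ?sqr_ge0|rewrite mulr_ge0// ltW].
Qed.

(** Here [al * D + be * D'] is [t * ((be - al) * k - al * (rm - rp))] with [k = lam * t - rm], and
    [lam_le] bounds it by [2 * t * (be - al) / (al + be)]. This is the hypothesis of [spread_step]
    up to strictness, which comes from [e > 0], or from the strict case of [lam_le] when
    [rm > 0]. *)
Lemma spread_right_step t e : 1 <= t -> super_level t !=set0 ->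
  0 < e \/ 0 <= e /\ (forall r, 
     (forall x, left_end t < x < right_end t -> rho x <= r) -> 0 < r) ->
  exists2 d, 0 < d & forall h, 0 < h < d -> super_level (t + h) !=set0 ->
    spread (t + h) < spread t + e * h.
Proof.
move=> t1 St He.
have [[aal albe beb] wal wbe _ _] := super_level_ends t1 St.
set al := left_end t in aal albe wal He *; set be := right_end t in albe beb wbe He *.
have al0 : 0 < al by apply: lt_le_trans aal.
have be0 : 0 < be by apply: lt_trans albe.
have t0 : 0 < t by lra.
have [rp [rm [hp hm rhoI]]] := one_sided_limits aal albe beb.
apply: (spread_step t1 St hp hm); rewrite -/al -/be.
have D0 := left_slope_ge0 t1 St hp; have D0' := right_slope_ge0 t1 St hm.
rewrite -/al -/be in D0 D0'.
have [rp0 rpm] : 0 <= rm /\ rp <= rm.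
  have [] := rhoI ((al + be) / 2); first lra.
  by move=> h1 h2 h3; split; [exact: le_trans h3|exact: le_trans h3].
have rhom x : al < x < be -> rho x <= rm by case/rhoI.
have [] := lam_le aal albe beb _ rp0 rhom; first by rewrite wal.
rewrite wal; set k := lam * t - rm => k2 k2'.
set S := al * _ + _.
have SE : S = t * ((be - al) * k - al * (rm - rp)).
  by rewrite /S /k; field; rewrite !gt_eqF.
have S0 : 0 <= S by rewrite addr_ge0// mulr_ge0// ltW.
have S2 : S <= t * ((be - al) * k).
  by rewrite SE ler_wpM2l ?gerBl ?mulr_ge0 ?subr_ge0// ltW.
have s0 : 0 < al + be by rewrite addr_gt0.
have Sk : S * (al + be) <= t * (be - al) * (k * (al + be)).
  by rewrite mulrA ler_pM2r// -mulrA.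
have tba : 0 < t * (be - al) by rewrite mulr_gt0// subr_gt0.
rewrite -(ltr_pM2r s0).
have XE : (2 * t * (al + be) ^+ 2 - e * (al * be)) * S * (al + be) =
  2 * t * (al + be) ^+ 2 * (S * (al + be)) - e * (al * be) * S * (al + be) by ring.
have YE : 4 * t ^+ 2 * (be ^+ 2 - al ^+ 2) * (al + be) =
  2 * t * (al + be) ^+ 2 * (t * (be - al) * 2) by ring.
have c0 : 0 < 2 * t * (al + be) ^+ 2 by rewrite !mulr_gt0// exprn_gt0.
have abS : 0 <= (al * be) * S * (al + be) by rewrite !mulr_ge0// ltW.
rewrite XE YE.
have Sk2 : S * (al + be) <= t * (be - al) * 2.
  by apply: (le_trans Sk); rewrite ler_pM2l.
case: He => [e0|[e0 rpos]].
  have [Seq|Sne] := eqVneq S 0.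
    by rewrite Seq mulr0 !mul0r mulr0 subr0 mulr_gt0// mulr_gt0.
  have Sgt0 : 0 < S by rewrite lt_neqAle eq_sym Sne.
  have : 0 < e * (al * be) * S * (al + be) by rewrite !mulr_gt0.
  have : 2 * t * (al + be) ^+ 2 * (S * (al + be)) <=
    2 * t * (al + be) ^+ 2 * (t * (be - al) * 2) by rewrite ler_pM2l.
  lra.
have rm0 : 0 < rm by exact: rpos.
have : 2 * t * (al + be) ^+ 2 * (S * (al + be)) <
    2 * t * (al + be) ^+ 2 * (t * (be - al) * 2).
  by rewrite ltr_pM2l// (le_lt_trans Sk)// ltr_pM2l// k2'.
have : 0 <= e * (al * be) * S * (al + be) by rewrite -!mulrA mulr_ge0// !mulrA.
lra.
Qed.

(** Real induction on the level: [spread_right_step] moves to the right, [spread_le] passes to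
    limits from the left. The slack [e] supplies strictness where [rho] may vanish. *)
Lemma spread_bound_eps t e : 1 <= t -> super_level t !=set0 -> 0 < e ->
  spread t <= spread 1 + e * (t - 1).
Proof.
move=> t1 St e0.
have Sc c : c <= t -> super_level c !=set0.
  by move=> ct; case: St => x /(super_level_le ct); exists x.
have S10 : 0 <= spread 1 by apply: spread_ge0 => //; exact: Sc.
apply: (@real_induction _ 1 t (fun c => spread c <= spread 1 + e * (c - 1))) => //.
- by rewrite subrr mulr0 addr0.
- move=> c /andP[c1 ct] Pc.
  have [d d0 H] := spread_right_step c1 (Sc c (ltW ct)) (or_introl e0).
  pose h := Num.min (d / 2) (t - c).
  have h0 : 0 < h by rewrite lt_min subr_gt0 ct divr_gt0.
  have hd : h <= d / 2 by rewrite ge_min lexx.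
  have ht : h <= t - c by rewrite ge_min lexx orbT.
  exists (c + h); first by apply/andP; split; lra.
  have := H h; rewrite h0/= => H'.
  have {}H' : spread (c + h) < spread c + e * h by apply: H'; [lra|apply: Sc; lra].
  lra.
- move=> c /andP[c1 ct] H.
  have Sc0 : 0 <= spread c by apply: spread_ge0; [exact: ltW|exact: Sc].
  rewrite leNgt; apply/negP; set K := spread 1 + _ => Kc.
  have c0 : 0 < c by exact: lt_trans c1.
  have K0 : 0 <= K by rewrite addr_ge0// mulr_ge0 ?subr_ge0// ltW.
  have sc0 : 0 < spread c by exact: le_lt_trans Kc.
  (* For [x > c - d] one has [x ^+ 2 >= c ^+ 2 - 2 * c * d], and [2 * c * d * spread c] is only half
     of [c ^+ 2 * (spread c - K)], which contradicts [spread_le]. *)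
  pose d := c * (spread c - K) / (4 * spread c).
  have d0 : 0 < d by apply: divr_gt0; apply: mulr_gt0; rewrite ?subr_gt0.
  have dE : 4 * d * spread c = c * (spread c - K).
    by rewrite /d; field; rewrite gt_eqF.
  have [x /andP[x1 xc] [dx Px]] := H d d0.
  have := spread_le x1 xc (Sc c ct).
  have PK : spread x <= K by apply: (le_trans Px); rewrite lerD2l ler_pM2l//; lra.
  have cK : c ^+ 2 * spread x <= c ^+ 2 * K by rewrite ler_wpM2l ?sqr_ge0.
  move=> /le_trans /(_ cK).
  have x2 : c ^+ 2 - 2 * c * d <= x ^+ 2.
    have : 0 <= 2 * c * (x - (c - d)) by rewrite !mulr_ge0//; lra.
    have := sqr_ge0 (c - x).
    lra.
  move=> H1.
  have H2 : spread c * (c ^+ 2 - 2 * c * d) <= c ^+ 2 * K.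
    by apply: le_trans H1; rewrite ler_wpM2l.
  have : c * (c * spread c - 2 * d * spread c - c * K) <= 0 by lra.
  rewrite pmulr_rle0//.
  have : 0 < c * (spread c - K) by rewrite mulr_gt0// subr_gt0.
  lra.
Qed.

Lemma spread_bound t : 1 <= t -> super_level t !=set0 -> spread t <= spread 1.
Proof.
move=> t1 St; apply/ler_addgt0Pr => e e0.
have te : 0 < e / t by rewrite divr_gt0//; lra.
apply: (le_trans (spread_bound_eps t1 St te)); rewrite lerD2l mulrAC.
rewrite ler_pdivrMr; last lra.
by rewrite ler_pM2l//; lra.
Qed.

Let S1 : super_level 1 !=set0.
Proof.
have ab' := ab; exists ((a + b) / 2); split; first lra.
by apply: w_gt1; rewrite in_itv/=; lra.
Qed.

Lemma left_end1 : left_end 1 = a.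
Proof.
have [[aal albe beb] wal _ _ _] := super_level_ends (lexx _) S1.
apply/eqP; rewrite eq_sym; move: aal; rewrite le_eqVlt => /predU1P[->//|aal].
have := @w_gt1 (left_end 1); rewrite wal ltxx in_itv/= aal (lt_le_trans albe)//.
by move=> /(_ isT).
Qed.

Lemma right_end1 : right_end 1 = b.
Proof.
have [[aal albe beb] _ wbe _ _] := super_level_ends (lexx _) S1.
apply/eqP; move: beb; rewrite le_eqVlt => /predU1P[->//|beb].
have := @w_gt1 (right_end 1); rewrite wbe ltxx in_itv/= beb (le_lt_trans aal)//.
by move=> /(_ isT).
Qed.

Lemma spread1 : spread 1 = (a + b) ^+ 2 / (a * b).
Proof. by rewrite /spread left_end1 right_end1 expr1n mul1r. Qed.

Lemma spread_strict : (exists2 x, x \in `[a, b[ & rho x != 0) ->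
  exists2 d, 0 < d & forall h, 0 < h < d -> super_level (1 + h) !=set0 ->
    spread (1 + h) < spread 1.
Proof.
move=> [x0]; rewrite in_itv/= => /andP[ax0 x0b] rx0.
have rx0_gt0 : 0 < rho x0.
  by rewrite lt_neqAle eq_sym rx0 rho_ge0// in_itv/= ax0 ltW.
have [|d d0 H] := @spread_right_step 1 0 (lexx _) S1.
  right; split=> // r; rewrite left_end1 right_end1 => rhor.
  (* As [x0] may be [a], the midpoint of [x0] and [b] is used: it is interior, and [rho] is at least
     [rho x0] there. *)
  have xm : a < (x0 + b) / 2 < b by lra.
  apply: (lt_le_trans rx0_gt0); apply: le_trans (rhor _ xm).
  by apply: rho_homo => //; lra.
by exists d => // h hd Sh; have := H h hd Sh; rewrite mul0r addr0.
Qed.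

End bvp.

(** * Linear uniqueness and the explicit solution for zero [rho] *)

(** Since [c <= K], the function [- f x ^+ 2 * expR (- (2 * K) * x)] is nondecreasing; it starts
    from 0 and is never positive. *)
Lemma gronwall0 (R : realType) (a b K : R) (f c : R -> R) :
  lip a b f -> f a = 0 ->
  {ae @lebesgue_measure R, forall x, x \in `]a, b[ ->
    is_derive x 1 f (c x * f x)} ->
  (forall x, a <= x <= b -> `|c x| <= K) ->
  forall x, a <= x <= b -> f x = 0.
Proof.
move=> lf fa df cK x /andP[ax xb].
have : (0 - f a * f a) * expR (- (2 * K) * a) <= (0 - f x * f x) * expR (- (2 * K) * x).
  apply: (@lip_ae_nondecreasing _ a x
    (fun y => (0 - f y * f y) * expR (- (2 * K) * y))) => //.
    apply: (@lip_sub _ a b) => //; apply: lipM.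
      by apply: lipB; [exact: lip_cst|exact: lipM].
    by apply: lip_expR; apply: lipM; [exact: lip_cst|exact: lip_id].
  move: df; apply: ae_lebesgueS => y dfy; rewrite in_itv/= => /andP[ay yx].
  have {}dfy := dfy _; rewrite in_itv/= ay (lt_le_trans yx)// in dfy.
  have {}dfy := dfy isT.
  have := is_derive_mul (is_derive_sub (is_derive_cst 0 y 1) (is_derive_mul dfy dfy))
    (is_derive_exp (is_derive_mul (is_derive_cst (- (2 * K)) y 1) (is_derive_id y 1))).
  set d := (X in is_derive _ _ _ X) => dF; exists d; first exact: dF.
  have -> : d = 2 * (f y ^+ 2 * expR (- (2 * K) * y)) * (K - c y).
    by rewrite /d /= /cst /id; ring.
  apply: mulr_ge0; first by rewrite mulr_ge0// mulr_ge0 ?expR_ge0 ?sqr_ge0.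
  rewrite subr_ge0.
  by rewrite (le_trans (ler_norm _))// cK// ltW// (le_trans (ltW yx)).
rewrite fa mulr0 subr0 mul0r sub0r mulNr oppr_ge0 pmulr_lle0 ?expR_gt0// -expr2.
by move=> f2; apply/eqP; rewrite -sqrf_eq0 eq_le f2 sqr_ge0.
Qed.

(** In this Bernoulli equation [x / w] has derivative [lam * x], hence should equal [g]. To avoid
    dividing by [w], whose sign is not known here, [w x * g x - x] is shown to solve a linear
    equation with coefficient [x^-1 - lam * w x]. The condition at [b] then determines [lam]. *)
Lemma bvp0_solution (R : realType) (a b lam : R) (w : R -> R) :
  0 < a -> a < b -> bvp_solution a b (fun=> 0) w lam ->
  forall x, a <= x <= b -> w x = (a + b) * x / (x ^+ 2 + a * b).
Proof.
move=> a0 ab [/lip_lipschitz lw dw wa wb].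
pose g x := a + lam * (x * x - a * a) / 2.
have lg : lip a b g.
  apply: lipD; first exact: lip_cst.
  apply: lipM; last exact: lip_cst.
  apply: lipM; first exact: lip_cst.
  by apply: lipB; [apply: lipM; exact: lip_id|exact: lip_cst].
have [M M0 wM] := lip_bounded lw.
have wg x : a <= x <= b -> w x * g x = x.
  move=> xab; apply/eqP; rewrite -subr_eq0; apply/eqP; move: x xab.
  apply: (@gronwall0 _ a b (a^-1 + `|lam| * M) (fun x => w x * g x - x)
    (fun x => x^-1 - lam * w x)).
  - by apply: lipB; [exact: lipM|exact: lip_id].
  - by rewrite /g wa subrr mulr0 mul0r addr0 mul1r subrr.
  - move: dw; apply: ae_lebesgueS => x H xab; have [dwx wE] := H xab.
    move: xab; rewrite in_itv/= => /andP[ax xb].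
    have x0 : 0 < x by exact: lt_trans ax.
    have {}dwx : is_derive x 1 w (w x * (x^-1 - lam * w x)).
      apply: DeriveDef => //; rewrite -derive1E.
      have -> : w^`()%classic x = (x^-1 + 0) * w x - lam * w x ^+ 2.
        by rewrite -wE addrK.
      ring.
    have did : is_derive x 1 (fun y : R => y) 1 := is_derive_id _ _.
    have dcst (z : R) : is_derive x 1 (fun=> z) 0 := is_derive_cst _ _ _.
    have := is_derive_sub (is_derive_mul dwx (is_derive_add (dcst a) (is_derive_mul
      (is_derive_mul (dcst lam) (is_derive_sub (is_derive_mul did did) (dcst (a * a))))
      (dcst 2^-1)))) did.
    set d := (X in is_derive _ _ _ X) => dF.
    have -> : (x^-1 - lam * w x) * (w x * g x - x) = d.
      by rewrite /d /g; field; rewrite gt_eqF.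
    exact: dF.
  - move=> x xab; have /andP[ax xb] := xab.
    have x0 : 0 < x by exact: lt_le_trans ax.
    rewrite (le_trans (ler_normB _ _))// normrM lerD//.
      by rewrite gtr0_norm ?invr_gt0// lef_pV2 ?posrE.
    by rewrite ler_wpM2l// wM.
have lamE : lam * (a + b) = 2.
  have := wg b; rewrite lexx (ltW ab) wb mul1r /g => /(_ isT) gb.
  have : (lam * (a + b) - 2) * (b - a) = 0 by lra.
  by move/eqP; rewrite mulf_eq0 !subr_eq0 (gt_eqF ab) orbF => /eqP.
have s0 : 0 < a + b by rewrite addr_gt0// (lt_trans a0).
move=> x xab; have := wg x xab.
have x0 : 0 < x by case/andP: xab => ax _; exact: lt_le_trans ax.
have lamV : lam = 2 / (a + b) by rewrite -lamE mulfK// gt_eqF.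
have q0 : 0 < x ^+ 2 + a * b.
  by rewrite ltr_wpDr ?exprn_gt0// mulr_ge0 ?ltW// (lt_trans a0).
have -> : g x = (x ^+ 2 + a * b) / (a + b).
  by rewrite /g lamV; field; rewrite gt_eqF.
move=> H; rewrite -{2}H; field; rewrite !gt_eqF//.
Qed.

(** * The measure of intervals and of superlevel sets *)

Section mu_inv.
Variable R : realType.
Implicit Types u v : R.

Lemma inv_continuous_within u v : 0 < u ->
  {within `[u, v], continuous (fun x : R => x^-1)}.
Proof.
move=> u0; apply: continuous_in_subspaceT => x; rewrite inE/= in_itv/= => /andP[ux _].
by apply: inv_continuous; rewrite gt_eqF// (lt_le_trans u0).
Qed.

Lemma measurable_fun_EFin_inv u v : 0 < u ->
  measurable_fun `[u, v] (fun x : R => (x^-1)%:E).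
Proof.
move=> u0; apply/measurable_EFinP.
by apply: subspace_continuous_measurable_fun => //; exact: inv_continuous_within.
Qed.

Lemma mu_inv_itv u v : 0 < u -> u < v -> mu_inv `]u, v[ = (ln v - ln u)%:E.
Proof.
move=> u0 uv; have v0 := lt_trans u0 uv.
have mf := @measurable_fun_EFin_inv u v u0.
rewrite /mu_inv integral_itv_bndo_bndc; last first.
  by apply: measurable_funS mf => //; apply: subset_itv; rewrite bnd_simp.
rewrite integral_itv_obnd_cbnd; last first.
  by apply: measurable_funS mf => //; apply: subset_itv; rewrite bnd_simp.
rewrite (@continuous_FTC2 _ (fun x => x^-1) (@ln R))//.
- exact: inv_continuous_within.
- split.
  + move=> x; rewrite in_itv/= => /andP[ux _].
    by have [] := is_derive1_ln (lt_trans u0 ux).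
  + by apply: cvg_at_right_filter; exact: continuous_ln.
  + by apply: cvg_at_left_filter; exact: continuous_ln.
- move=> x; rewrite in_itv/= => /andP[ux _].
  by rewrite derive1E; have [_ ->] := is_derive1_ln (lt_trans u0 ux).
Qed.

Lemma le_mu_inv (a b : R) (A B : set R) : 0 < a -> measurable A -> measurable B ->
  B `<=` `[a, b] -> A `<=` B -> (mu_inv A <= mu_inv B)%E.
Proof.
move=> a0 mA mB Bab AB; apply: ge0_subset_integral => //.
  apply: measurable_funS (@measurable_fun_EFin_inv a b a0) => //.
move=> x /Bab; rewrite /= in_itv/= => /andP[ax _].
by rewrite lee_fin invr_ge0 ltW// (lt_le_trans a0).
Qed.

Lemma measurable_super_level (a b t : R) (u : R -> R) : lip a b u ->
  measurable [set x | x \in `[a, b] /\ t < u x].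
Proof.
move=> /lip_continuous uc.
have mu' : measurable_fun `[a, b] u by exact: subspace_continuous_measurable_fun.
have -> : [set x | x \in `[a, b] /\ t < u x] = `[a, b] `&` u @^-1` `]t, +oo[.
  by apply/seteqP; split=> x /=; rewrite !in_itv/= andbT.
exact: mu'.
Qed.

End mu_inv.

(** On [[a, b]], [w x > t] means [t * (x ^+ 2 + a * b) < (a + b) * x], which holds on []u, v[] when
    [u * v = a * b] and [t * (u + v) <= a + b]. The last hypothesis is the square root of a
    comparison of spreads; a spare factor [th] gains [2 * ln th] in measure. *)
Lemma distribution_fun_ge (R : realType) (a b lam al be t th : R) (w : R -> R) :
  0 < a -> a < b -> bvp_solution a b (fun=> 0) w lam ->
  0 < al -> al < be -> 1 <= t -> 1 <= th ->
  th * (t * (al + be) * Num.sqrt (a * b)) <= (a + b) * Num.sqrt (al * be) ->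
  ((ln be - ln al + 2 * ln th)%:E <= distribution_fun a b w t)%E.
Proof.
move=> a0 ab w_sol al0 albe t1 th1.
have b0 := lt_trans a0 ab; have be0 := lt_trans al0 albe.
have t0 := lt_le_trans ltr01 t1; have th0 := lt_le_trans ltr01 th1.
have A0 : 0 < Num.sqrt (a * b) by rewrite sqrtr_gt0 mulr_gt0.
have B0 : 0 < Num.sqrt (al * be) by rewrite sqrtr_gt0 mulr_gt0.
have A2 : Num.sqrt (a * b) ^+ 2 = a * b by rewrite sqr_sqrtr// ltW// mulr_gt0.
have B2 : Num.sqrt (al * be) ^+ 2 = al * be by rewrite sqr_sqrtr// ltW// mulr_gt0.
set A := Num.sqrt (a * b) in A0 A2 *; set B := Num.sqrt (al * be) in B0 B2 *.
move=> H.
(* Dilate ]al, be[ so that the product of its end points becomes a * b, then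
   enlarge it by the factor th on both sides. *)
pose s := A / B.
have s0 : 0 < s by rewrite divr_gt0.
pose u := s * al / th; pose v := s * be * th.
have u0 : 0 < u by rewrite divr_gt0// mulr_gt0.
have v0 : 0 < v by rewrite mulr_gt0// mulr_gt0.
have uvE : u * v = a * b.
  have -> : u * v = A ^+ 2 * (al * be) / B ^+ 2.
    by rewrite /u /v /s; field; rewrite !gt_eqF.
  by rewrite A2 B2 mulfK// gt_eqF// mulr_gt0.
have uv : u < v.
  apply: (@le_lt_trans _ _ (s * al)).
    by rewrite /u ler_pdivrMr// ler_peMr// ltW// mulr_gt0.
  by apply: (@lt_le_trans _ _ (s * be)); rewrite ?ltr_pM2l// /v ler_peMr// ltW// mulr_gt0.
have uvs : t * (u + v) <= a + b.
  apply: (@le_trans _ _ (th * (t * (al + be) * A) / B)); last first.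
    by rewrite ler_pdivrMr.
  have -> : th * (t * (al + be) * A) / B = t * (s * al * th + v) by rewrite /v /s; ring.
  rewrite ler_pM2l// lerD2r /u ler_pdivrMr// -[leRHS]mulrA.
  by apply: ler_peMr; [rewrite ltW// mulr_gt0|exact: mulr_ege1].
have -> : ln be - ln al + 2 * ln th = ln v - ln u.
  have sal0 : 0 < s * al by rewrite mulr_gt0.
  have sbe0 : 0 < s * be by rewrite mulr_gt0.
  rewrite /u ln_div// /v (lnM sbe0 th0) (lnM s0 be0) (lnM s0 al0); ring.
rewrite -mu_inv_itv//.
have [w_lip _ _ _] := w_sol.
apply: (@le_mu_inv _ a b) => //.
- by apply: measurable_super_level; exact: lip_lipschitz.
- by move=> x [].
- move=> x /=; rewrite in_itv/= => /andP[ux xv].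
  have x0 : 0 < x by exact: lt_trans ux.
  have q0 : 0 < x ^+ 2 + a * b by rewrite addr_gt0 ?exprn_gt0// mulr_gt0.
  have H1 : x ^+ 2 + a * b < (u + v) * x.
    have : 0 < (x - u) * (v - x) by rewrite mulr_gt0// subr_gt0.
    rewrite -uvE; lra.
  have H2 : t * (x ^+ 2 + a * b) < (a + b) * x.
    apply: (@lt_le_trans _ _ (t * ((u + v) * x))); first by rewrite ltr_pM2l.
    by rewrite mulrA ler_pM2r.
  (* As [t >= 1], the inequality at level [t] implies the one at level 1, which factors in this way
     and confines [x] to []a, b[]. *)
  have H3 : 0 < (x - a) * (b - x).
    have : 0 <= (t - 1) * (x ^+ 2 + a * b) by rewrite mulr_ge0 ?subr_ge0// ltW.
    lra.
  have ax : a < x.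
    rewrite ltNge; apply/negP => xa; move: H3; apply/negP; rewrite -leNgt.
    by rewrite mulr_le0_ge0 ?subr_le0 ?subr_ge0// (le_trans xa)// ltW.
  have xb : x < b by move: H3; rewrite pmulr_rgt0 ?subr_gt0.
  have xab : a <= x <= b by rewrite !ltW.
  rewrite in_itv/=; split=> //.
  by rewrite (bvp0_solution a0 ab w_sol xab) ltr_pdivlMr.
Qed.

(** * Supremum norms and the comparison of the two solutions *)

Lemma sup_norm_ge (R : realType) (a b x : R) (u : R -> R) :
  lip a b u -> a <= x <= b -> `|u x| <= sup_norm a b u.
Proof.
move=> /lip_bounded[M _ uM] xab; apply: ub_le_sup.
  by exists M => _ [y + <-] => /=; rewrite in_itv/=; exact: uM.
by exists x => //=; rewrite in_itv.
Qed.

Lemma sup_norm_gt (R : realType) (a b t : R) (u : R -> R) :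
  a <= b -> lip a b u -> t < sup_norm a b u ->
  exists2 x, a <= x <= b & t < `|u x|.
Proof.
move=> ab /lip_bounded[M _ uM] tu.
have [|_ [x + <-] tx] := sup_gt _ tu.
  by exists `|u a|, a => //=; rewrite in_itv/= lexx.
by rewrite /= in_itv/=; exists x.
Qed.

Theorem theorem9p15 (R : realType) (a b : R) (rho w w0 : R -> R)
    (lam lam0 : R) (T : R)
    (a_gt0 : 0 < a) (ab : a < b)
    (rho_ge0 : forall x, x \in `[a, b] -> 0 <= rho x)
    (rho_nd : {in `[a, b] &, {homo rho : x y / x <= y}})
    (rho_bnd : [bounded rho x | x in `[a, b]])
    (w_sol : bvp_solution a b rho w lam)
    (w0_sol : bvp_solution a b (fun=> 0) w0 lam0)
    (w_gt1 : forall x, x \in `]a, b[ -> 1 < w x)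
    (T_def : T = Num.min (sup_norm a b w0) (sup_norm a b w)) :
  [/\ 1 < T,
      forall t, t \in `[1, T[ ->
        (distribution_fun a b w t <= distribution_fun a b w0 t)%E,
      sup_norm a b w <= sup_norm a b w0 &
      (exists2 x, x \in `[a, b[ & rho x != 0) ->
      exists2 t0, t0 \in `]1, sup_norm a b w[ &
        forall t, t \in `]1, t0[ ->
          (distribution_fun a b w t < distribution_fun a b w0 t)%E].
Proof.
have b_gt0 := lt_trans a_gt0 ab.
have w_lip : lip a b w by case: w_sol => /lip_lipschitz.
have w0_lip : lip a b w0 by case: w0_sol => /lip_lipschitz.
have w0E := bvp0_solution a_gt0 ab w0_sol.
have w_ge1 := bvp_solution_ge1 w_sol w_gt1.
pose m := (a + b) / 2.
have am : a < m by rewrite /m; lra.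
have mb : m < b by rewrite /m; lra.
have mab : a <= m <= b by rewrite !ltW.
have W_gt1 : 1 < sup_norm a b w.
  apply: lt_le_trans (sup_norm_ge w_lip mab); rewrite (lt_le_trans _ (ler_norm _))//.
  by apply: w_gt1; rewrite in_itv/= am.
have W0_gt1 : 1 < sup_norm a b w0.
  apply: lt_le_trans (sup_norm_ge w0_lip mab); rewrite (lt_le_trans _ (ler_norm _))//.
  rewrite w0E// ltr_pdivlMr ?mul1r; last first.
    by apply: addr_gt0; [apply: exprn_gt0; exact: lt_trans am|exact: mulr_gt0].
  have : 0 < (m - a) * (b - m) by rewrite mulr_gt0// subr_gt0.
  lra.
have level t : t < sup_norm a b w -> super_level a b w t !=set0.
  move=> /(sup_norm_gt (ltW ab) w_lip)[x xab].
  rewrite ger0_norm ?(le_trans _ (w_ge1 x xab))//.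
  by exists x.
pose al := left_end a b w; pose be := right_end a b w.
pose A := Num.sqrt (a * b); pose B t := Num.sqrt (al t * be t).
have A0 : 0 < A by rewrite sqrtr_gt0 mulr_gt0.
have A2 : A ^+ 2 = a * b by rewrite sqr_sqrtr// ltW// mulr_gt0.
have ends t : 1 <= t -> t < sup_norm a b w -> [/\ a <= al t, al t < be t & be t <= b].
  move=> t1 /level St.
  by have [] := super_level_ends w_sol t1 St.
have BE t : 1 <= t -> t < sup_norm a b w ->
    [/\ 0 < al t, 0 < be t, 0 < B t & B t ^+ 2 = al t * be t].
  move=> t1 tW; have [aal albe _] := ends t t1 tW.
  have al0 : 0 < al t := lt_le_trans a_gt0 aal.
  have be0 : 0 < be t := lt_trans al0 albe.
  by split=> //; rewrite /B ?sqrtr_gt0 ?mulr_gt0// sqr_sqrtr// ltW// mulr_gt0.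
have spreadE t : 1 <= t -> t < sup_norm a b w ->
    spread a b w t = (t * (al t + be t) / B t) ^+ 2.
  move=> t1 tW; have [al0 be0 B0 B2] := BE t t1 tW.
  by rewrite !exprMn exprVn B2.
have spread1E : spread a b w 1 = ((a + b) / A) ^+ 2.
  by rewrite (spread1 ab w_sol w_gt1) exprMn exprVn A2.
have dist_le t : 1 <= t -> t < sup_norm a b w ->
    (distribution_fun a b w t <= (ln (be t) - ln (al t))%:E)%E.
  move=> t1 tW; have [aal albe beb] := ends t t1 tW; have [al0 be0 _ _] := BE t t1 tW.
  have [_ _ _ Slt _] := super_level_ends w_sol t1 (level t tW).
  rewrite -mu_inv_itv//; apply: (@le_mu_inv _ a b) => //.
    exact: measurable_super_level.
  by apply: subset_itv; rewrite bnd_simp.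
(* This is the square root of [spread t <= spread 1], in the form that [distribution_fun_ge] takes
   for [th = 1]. *)
have key t : 1 <= t -> t < sup_norm a b w ->
    t * (al t + be t) * A <= (a + b) * B t.
  move=> t1 tW; have [al0 be0 B0 _] := BE t t1 tW.
  have := spread_bound a_gt0 rho_ge0 rho_nd w_sol w_gt1 t1 (level t tW).
  rewrite spreadE// spread1E ler_sqr ?nnegrE.
  - by rewrite ler_pdivrMr// mulrAC ler_pdivlMr.
  - by rewrite divr_ge0 ?mulr_ge0 ?addr_ge0// ?ltW// (lt_le_trans ltr01).
  - by rewrite divr_ge0 ?addr_ge0// ltW.
(* At a level [t] between the two norms, [key] and the inequality of the means
   [2 * B t <= al t + be t] give [t <= (a + b) / (2 * A)]. This is the value of [w0] at the
   geometric mean [A] of [a] and [b], hence at most the norm of [w0]. *)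
have W_le : sup_norm a b w <= sup_norm a b w0.
  rewrite leNgt; apply/negP => WW0.
  pose t := (sup_norm a b w0 + sup_norm a b w) / 2.
  have t1 : 1 <= t by rewrite /t; lra.
  have tW : t < sup_norm a b w by rewrite /t; lra.
  have [al0 be0 B0 B2] := BE t t1 tW.
  have B2le : 2 * B t <= al t + be t.
    rewrite -ler_sqr ?nnegrE.
    - rewrite exprMn B2; have := sqr_ge0 (al t - be t); lra.
    - by rewrite mulr_ge0// ltW.
    - by rewrite ltW// addr_gt0.
  have tA : t * (2 * A) <= a + b.
    rewrite -(ler_pM2r B0); apply: le_trans (key t t1 tW).
    have -> : t * (2 * A) * B t = t * A * (2 * B t) by ring.
    rewrite (_ : t * _ * A = t * A * (al t + be t)); last by ring.
    by rewrite ler_wpM2l// mulr_ge0 ?ltW// (lt_le_trans ltr01).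
  have Aab : a <= A <= b.
    apply/andP; split.
      rewrite -ler_sqr ?nnegrE; [|exact: ltW..].
      by rewrite A2 expr2 ler_pM2l// ltW.
    rewrite -ler_sqr ?nnegrE; [|exact: ltW..].
    by rewrite A2 expr2 ler_pM2r// ltW.
  have := sup_norm_ge w0_lip Aab.
  have -> : w0 A = (a + b) / (2 * A).
    by rewrite w0E// A2 -A2; field; rewrite !gt_eqF// addr_gt0 ?exprn_gt0.
  move=> /(le_trans (ler_norm _)) H.
  have : t <= (a + b) / (2 * A) by rewrite ler_pdivlMr// mulr_gt0.
  move: H; rewrite /t; lra.
have TE : T = sup_norm a b w by rewrite T_def; exact/min_idPr.
split=> //; first by rewrite TE.
- move=> t; rewrite TE in_itv/= => /andP[t1 tW].
  apply: (le_trans (dist_le t t1 tW)).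
  have [al0 _ _ _] := BE t t1 tW; have [_ albe _] := ends t t1 tW.
  have := distribution_fun_ge a_gt0 ab w0_sol al0 albe t1 (lexx 1).
  by rewrite ln1 mulr0 addr0; apply; rewrite mul1r; exact: key.
move=> rho_neq0.
have [d d0 H] := spread_strict a_gt0 ab rho_ge0 rho_nd w_sol w_gt1 rho_neq0.
pose e := Num.min d ((sup_norm a b w - 1) / 2).
have e0 : 0 < e by rewrite lt_min d0 divr_gt0// subr_gt0.
have eW : e <= (sup_norm a b w - 1) / 2 by rewrite ge_min lexx orbT.
have ed : e <= d by rewrite ge_min lexx.
exists (1 + e); first by rewrite in_itv/=; lra.
move=> t; rewrite in_itv/= => /andP[t_gt1 te].
have t1 := ltW t_gt1.
have tW : t < sup_norm a b w by lra.
have [al0 be0 B0 _] := BE t t1 tW; have [_ albe _] := ends t t1 tW.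
have tAB : t * (al t + be t) * A < (a + b) * B t.
  have := H (t - 1); rewrite subrKC => /(_ _ (level t tW)).
  rewrite spreadE// spread1E => sp.
  rewrite -ltr_pdivlMr// mulrAC -ltr_pdivrMr//.
  rewrite -ltr_sqr ?nnegrE; first by apply: sp; lra.
  - by rewrite divr_ge0 ?mulr_ge0 ?addr_ge0// ?ltW// (lt_le_trans ltr01).
  - by rewrite divr_ge0 ?addr_ge0// ltW.
have P0 : 0 < t * (al t + be t) * A by rewrite !mulr_gt0 ?addr_gt0// (lt_trans ltr01).
(* [th] is the whole surplus in [tAB]; its logarithm is the strict gap between the measures. *)
pose th := (a + b) * B t / (t * (al t + be t) * A).
have th1 : 1 < th by rewrite ltr_pdivlMr// mul1r.
apply: (le_lt_trans (dist_le t t1 tW)).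
apply: lt_le_trans (distribution_fun_ge a_gt0 ab w0_sol al0 albe t1 (ltW th1) _).
  by rewrite lte_fin ltrDl mulr_gt0// ln_gt0.
by rewrite divfK// gt_eqF.
Qed.
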